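(* Let $A$ be a square complex matrix that is not unitarily similar to a direct sum of (two) square matrices of smaller positive sizes, and let $S^{-1}AS=\bar A$ for a unitary matrix $S$. Then $A$ is unitarily similar to a real matrix if and only if $S$ is symmetric.
   Context: $\bar A$ denotes the entrywise complex conjugate of $A$. Two square matrices $A,B$ are unitarily similar if $B=U^{-1}AU$ for some unitary matrix $U$. Symmetric means $S^T=S$. (Such an $S$ exists whenever $A$ is unitarily similar to a real matrix.) *)

(* Defs.v *)
From HB Require Import structures.
From mathcomp Require Import all_boot all_order all_algebra.
From mathcomp Require Import reals.
From mathcomp Require Import complex.

Set Implicit Arguments.
Unset Strict Implicit.
Unset Printing Implicit Defensive.

Import Order.TTheory GRing.Theory Num.Theory.
Local Open Scope ring_scope.

Definition unitarily_similar (C : numClosedFieldType) (n : nat)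
    (A B : 'M[C]_n) : Prop :=
  exists U : 'M[C]_n, U \is unitarymx /\ B = invmx U *m A *m U.

(* [p + q = n] with [p, q] positive makes both summands smaller than [n]; the
   equation is only used to cast the block matrix to size [n]. *)
Definition unitarily_decomposable (C : numClosedFieldType) (n : nat)
    (A : 'M[C]_n) : Prop :=
  exists (p q : nat) (pq : (p + q)%N = n) (A1 : 'M[C]_p) (A2 : 'M[C]_q),
    [/\ (0 < p)%N, (0 < q)%N &
        unitarily_similar A (castmx (pq, pq) (block_mx A1 0 0 A2))].

(* Main.v *)
(* If B = U^* A U is real, then B is its own conjugate, and A^- = S^* A S shows
   that the unitary matrix W = S U^- U^* commutes with A.  An eigenspace of W is
   then stable under A and A^*; as A is indecomposable, this eigenspace is the
   whole space, so W = c I and S = c U U^T is symmetric.  Conversely, a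
   symmetric unitary S factors as T T^T with T unitary, and T^* A T is real.
   Here X^- is the entrywise conjugate of X and X^* its conjugate transpose. *)
Require Import Defs.
From HB Require Import structures.
From mathcomp Require Import all_boot all_order all_algebra.
From mathcomp Require Import reals.
From mathcomp Require Import complex.

Set Implicit Arguments.
Unset Strict Implicit.
Unset Printing Implicit Defensive.

Import Order.TTheory GRing.Theory Num.Theory.
Local Open Scope ring_scope.
Local Open Scope sesquilinear_scope.

Section NumClosed.
Variable C : numClosedFieldType.

Local Notation "B ^!" :=
  (orthomx (@Num.conj C) (mx_of_hermitian (hermitian1mx _)) B)
  : matrix_set_scope.

Lemma trmxC_mul m n p (A : 'M[C]_(m, n)) (B : 'M[C]_(n, p)) :
  (A *m B)^t* = B^t* *m A^t*.
Proof. by rewrite trmx_mul map_mxM. Qed.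

Lemma unitarymx_trCP n {M : 'M[C]_n} :
  reflect (M^t* *m M = 1%:M) (M \is unitarymx).
Proof. by apply: (iffP unitarymxP) => /mulmx1C. Qed.

Lemma mulmx_conj_tr n (U : 'M[C]_n) :
  U \is unitarymx -> map_mx Num.conj U *m U^T = 1%:M.
Proof. by rewrite -trmx_unitary => /unitarymx_trCP; rewrite trmxK. Qed.

(** Stacking [E] over [F] gives a unitary matrix; in the basis of its rows, [E A F^*] and [F A E^*]
    are the off-diagonal blocks of [A]. *)
Lemma decomposable_col_mx n p q (pq : (p + q)%N = n) (A : 'M[C]_n)
    (E : 'M[C]_(p, n)) (F : 'M[C]_(q, n)) :
    (0 < p)%N -> (0 < q)%N -> E \is unitarymx -> F \is unitarymx ->
    E *m F^t* = 0 -> E *m A *m F^t* = 0 -> F *m A *m E^t* = 0 ->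
  unitarily_decomposable A.
Proof.
case: n / pq in A E F *; move=> p0 q0 /unitarymxP EE /unitarymxP FF EF EAF FAE.
have FE : F *m E^t* = 0.
  by rewrite -[F]trmxCK -trmxC_mul EF trmx0 map_mx0.
have uEF : col_mx E F \is unitarymx.
  apply/unitarymxP; rewrite tr_col_mx map_row_mx mul_col_row EE FF EF FE.
  by rewrite -scalar_mx_block.
exists p, q, erefl, (E *m A *m E^t*), (F *m A *m F^t*); split=> //.
exists ((col_mx E F)^t*); split; first by rewrite trmxC_unitary.
rewrite castmx_id invmx_unitary ?trmxC_unitary// trmxCK.
by rewrite mul_col_mx tr_col_mx map_row_mx mul_col_row EAF FAE.
Qed.

(** Take orthonormal bases [E] of [V] and [F] of its orthogonal complement: stability under [A]
    kills one off-diagonal block, stability under [A^*] the other. *)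
Lemma decomposable_reducing n (A V : 'M[C]_n) :
    (0 < \rank V < n)%N -> stablemx V A -> stablemx V (A^t*) ->
  unitarily_decomposable A.
Proof.
case/andP=> V0 Vn VA VA'.
have eqs (X : 'M[C]_n) : (schmidt (row_base X) :=: X)%MS.
  exact: eqmx_trans (eqmx_schmidt_free (row_base_free X)) (eq_row_base X).
have uni (X : 'M[C]_n) : schmidt (row_base X) \is unitarymx.
  by rewrite schmidt_unitarymx// rank_leq_col.
have ort m (X : 'M[C]_(m, n)) :
    (X <= V)%MS -> X *m (schmidt (row_base (V^!)%MS))^t* = 0.
  move=> XV; apply/orthomx1P.
  by rewrite orthomx_sym eqs submx_ortho.
have stab (B : 'M[C]_n) :
    stablemx V B -> (schmidt (row_base V) *m B <= V)%MS.
  by apply: submx_trans; rewrite submxMr// eqs.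
apply: (decomposable_col_mx (add_rank_ortho V) _ _ (uni V) (uni _)) => //.
- by rewrite rank_ortho subn_gt0.
- by apply: ort; rewrite eqs.
- by apply: ort; apply: stab.
(* The block [F A E^*] is the adjoint of [E A^* F^*], which vanishes as [V] is stable under
   [A^*]. *)
- apply: (can_inj (@trmxCK _ _ _)); rewrite !trmxC_mul trmxCK trmx0 map_mx0.
  by rewrite mulmxA ort// stab.
Qed.

Lemma comm_unitary_scalar n (A W : 'M[C]_n) :
    ~ unitarily_decomposable A -> W \is unitarymx -> comm_mx W A ->
  exists c : C, W = c%:M.
Proof.
case: n A W => [|n] A W indecA unitW cWA.
  (* In size 0 there is no eigenvalue, but any scalar will do. *)
  by exists 0; apply/matrixP=> - [].
have [c cW] := eigenvalue_closed W isT; exists c.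
have WAW : W *m A *m W^t* = A by rewrite cWA mulmxtVK.
(* The adjoint of [W A W^* = A] is [W A^* W^* = A^*]. *)
have cWA' : comm_mx W (A^t*).
  rewrite /comm_mx -[in RHS]WAW !trmxC_mul trmxCK mulmxA.
  by rewrite mulmxKtV.
have rkW : \rank (eigenspace W c) = n.+1.
  apply/eqP; rewrite eqn_leq rank_leq_col leqNgt; apply/negP => rkW.
  apply: indecA; apply: (@decomposable_reducing _ _ (eigenspace W c)).
  - by rewrite rkW lt0n mxrank_eq0 andbT; exact: cW.
  - exact: comm_mx_stable_eigenspace.
  - exact: comm_mx_stable_eigenspace.
have /eigenspaceP : (1%:M <= eigenspace W c)%MS by rewrite sub1mx /row_full rkW.
by rewrite mul1mx scalemx1.
Qed.

(* T is the square root of S obtained by taking square roots of the eigenvalues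
   in a unitary diagonalization P of S.  It inherits the symmetry of S: the
   latter says that P P^T commutes with the diagonal matrix of eigenvalues, and
   then it also commutes with any function of this matrix. *)
Lemma unitary_sym_factor n (S : 'M[C]_n) :
    S \is unitarymx -> S^T = S ->
  exists2 T : 'M[C]_n, T \is unitarymx & S = T *m T^T.
Proof.
move=> unitS symS; set P := spectralmx S; set d := spectral_diag S.
have unitP : P \is unitarymx := spectral_unitarymx S.
have SE : S = P^t* *m diag_mx d *m P.
  rewrite -invmx_unitary//; apply/orthomx_spectralP/normalmxP.
  by rewrite (unitarymxP unitS) (unitarymx_trCP unitS).
have dE : diag_mx d = P *m S *m P^t*.
  by rewrite SE !mulmxA (unitarymxP unitP) mul1mx mulmxtVK.
(* The eigenvalues of a unitary matrix have modulus 1, hence so do their square roots. *)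
have d1 i : d 0 i * (d 0 i)^* = 1.
  have /unitarymxP/matrixP/(_ i i) : diag_mx d \is unitarymx.
    by rewrite dE !mul_unitarymx ?trmxC_unitary.
  by rewrite tr_diag_mx map_diag_mx mulmx_diag !mxE eqxx.
pose e := map_mx sqrtC d.
have ee : diag_mx e *m diag_mx e = diag_mx d.
  rewrite mulmx_diag; congr diag_mx; apply/rowP => i.
  by rewrite !mxE -expr2 sqrtCK.
have unite : diag_mx e \is unitarymx.
  apply/unitarymxP; rewrite tr_diag_mx map_diag_mx mulmx_diag -diag_const_mx.
  congr diag_mx; apply/rowP => i; rewrite !mxE -normCK -normrX sqrtCK.
  by apply/eqP; rewrite -(@pexpr_eq1 _ _ 2)// normCK d1.
have PPT := mulmx_conj_tr unitP.
(* The transpose is [P^T D P^-] with [D = diag_mx f]; multiplying by [P] on the left and [P^T] on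
   the right uses [P^- P^T = 1]. *)
have symE (f : 'rV_n) :
    ((P^t* *m diag_mx f *m P)^T = P^t* *m diag_mx f *m P) <->
    comm_mx (P *m P^T) (diag_mx f).
  have -> : (P^t* *m diag_mx f *m P)^T = P^T *m diag_mx f *m map_mx Num.conj P.
    by rewrite !trmx_mul tr_diag_mx map_trmx trmxK mulmxA.
  split=> [|cPf].
    move=> /(congr1 (fun X => P *m X *m P^T)); rewrite /comm_mx !mulmxA.
    by rewrite (unitarymxP unitP) mul1mx -[X in X = _ -> _]mulmxA PPT mulmx1.
  have: P *m (P^T *m diag_mx f *m map_mx Num.conj P) = diag_mx f *m P.
    by rewrite !mulmxA cPf -!mulmxA (mulmx1C PPT) mulmx1.
  move=> /(congr1 (mulmx (P^t*))).
  by rewrite !mulmxA (unitarymx_trCP unitP) mul1mx.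
have /symE cd : (P^t* *m diag_mx d *m P)^T = P^t* *m diag_mx d *m P.
  by rewrite -SE.
have eM : (P^t* *m diag_mx e *m P)^T = P^t* *m diag_mx e *m P.
  (* Where the entry [i j] of [P P^T] is nonzero, commutation forces equal eigenvalues, hence equal
     roots. *)
  apply/symE/matrixP => i j; move: cd => /matrixP/(_ i j).
  rewrite !mul_diag_mx !mul_mx_diag mxE [RHS]mxE => cd.
  rewrite mxE [RHS]mxE; move: cd; rewrite [e 0 j]mxE [e 0 i]mxE.
  have [-> _|m0] := eqVneq ((P *m P^T) i j) 0; first by rewrite mul0r mulr0.
  by rewrite ![_ * (P *m P^T) i j]mulrC => /(mulfI m0) ->.
exists (P^t* *m diag_mx e *m P).
  by rewrite !mul_unitarymx ?trmxC_unitary.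
by rewrite eM !mulmxA mulmxtVK// -[P^t* *m _ *m _]mulmxA ee.
Qed.

Lemma unitary_real_similar n (A S : 'M[C]_n) :
    ~ unitarily_decomposable A -> S \is unitarymx ->
    invmx S *m A *m S = map_mx Num.conj A ->
  (exists B : 'M[C]_n, B \is a realmx /\ unitarily_similar A B) <-> S^T = S.
Proof.
move=> indecA unitS; rewrite invmx_unitary// => conjA; split; last first.
  move=> /(unitary_sym_factor unitS)[T unitT ST].
  exists (invmx T *m A *m T); split; last by exists T.
  suff BB : map_mx Num.conj (invmx T *m A *m T) = invmx T *m A *m T.
    by apply/mxOverP => i j; apply/CrealP; rewrite -[in RHS]BB [RHS]mxE.
  (* This absorbs the [S] that conjugating [T^* A T] brings in. *)
  have STc : S *m map_mx Num.conj T = T.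
    by rewrite ST -mulmxA (mulmx1C (mulmx_conj_tr unitT)) mulmx1.
  have cST : map_mx Num.conj (T^t*) *m S^t* = T^t*.
    by rewrite -[in RHS]STc trmxC_mul map_trmx.
  rewrite invmx_unitary// !map_mxM -conjA !mulmxA cST -mulmxA STc.
  reflexivity.
case=> B [realB [U [unitU BE]]]; rewrite invmx_unitary// in BE.
pose V := S *m map_mx Num.conj U.
have unitV : V \is unitarymx by rewrite mul_unitarymx ?conjC_unitary.
have VAV : U^t* *m A *m U = V^t* *m A *m V.
  rewrite -BE -(realmxC realB) BE !map_mxM -conjA trmxC_mul -map_trmx.
  by rewrite !mulmxA.
have [||c] := comm_unitary_scalar (W := V *m U^t*) indecA.
- by rewrite mul_unitarymx ?trmxC_unitary.
- rewrite /comm_mx -[in LHS](mulmxtVK A unitU) -!mulmxA.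
  have := congr1 (mulmx^~ (U^t*)) (congr1 (mulmx V) VAV).
  by rewrite !mulmxA (unitarymxP unitV) mul1mx.
(* Now [S U^- = c U], and multiplying by [U^T] cancels [U^-]. *)
move=> /(congr1 (mulmx^~ U)); rewrite mulmxKtV// mul_scalar_mx.
move=> /(congr1 (mulmx^~ U^T)).
rewrite -mulmxA mulmx_conj_tr// mulmx1 -scalemxAl => ->.
by rewrite linearZ /= trmx_mul trmxK.
Qed.

End NumClosed.

Theorem corollary4p1 (R : realType) (n : nat) (A S : 'M[R[i]]_n)
    (indecA : ~ unitarily_decomposable A)
    (unitS : S \is unitarymx)
    (conjA : invmx S *m A *m S = map_mx Num.conj A) :
  (exists B : 'M[R[i]]_n, B \is a realmx /\ unitarily_similar A B) <-> S^T = S.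
Proof. exact: unitary_real_similar. Qed.
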